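(* Let $d\ge1$, $\mathbf n\in\mathbb N^d$, and let $\{Y_{\mathbf k};\ \mathbf k\le\mathbf n\}$ be a negatively associated field of random variables with $\mathbb E Y_{\mathbf k}=0$ and $|Y_{\mathbf k}|\le b$ a.s. for some $0<b<\infty$. Let $T_{\mathbf k}=\sum_{\mathbf i\le\mathbf k}Y_{\mathbf i}$, $M_{\mathbf n}=\max_{\mathbf k\le\mathbf n}|T_{\mathbf k}|$ and $B_{\mathbf n}^2=\sum_{\mathbf k\le\mathbf n}\mathbb E Y_{\mathbf k}^2$. Then for all $x>0$, $$\mathbb P\big(M_{\mathbf n}-2\mathbb E M_{\mathbf n}\ge 20x\big)\le 2^{d+1}\exp\Big(-\frac{x^2}{2(bx+B_{\mathbf n}^2)}\Big).$$
   Context: A finite family of random variables $\{Y_i; i\in I\}$ is negatively associated if for every pair of disjoint subsets $A,B\subset I$, $\operatorname{Cov}(f(Y_i;i\in A),g(Y_j;j\in B))\le 0$ whenever $f,g$ are coordinatewise non-decreasing and the covariance exists. Indices are in $\mathbb N^d$ (positive integer coordinates), and $\mathbf k\le\mathbf n$ means $k_i\le n_i$ for all $i=1,\dots,d$. *)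

(* Defs.v *)
From HB Require Import structures.
From mathcomp Require Import all_boot all_order all_algebra.
From mathcomp Require Import all_classical all_reals all_analysis.
Set Implicit Arguments. Unset Strict Implicit. Unset Printing Implicit Defensive.
Import Order.TTheory GRing.Theory Num.Theory.
Local Open Scope ring_scope.

(* The index box {k in N^d : 1 <= k <= n}, encoded 0-based:
   k i : 'I_(n i) stands for the coordinate k_i = (k i) + 1 in {1..n_i}. *)
Definition box (d : nat) (n : 'I_d -> nat) : finType :=
  {dffun forall i : 'I_d, 'I_(n i)}.

Definition leidx (d : nat) (n : 'I_d -> nat) (j k : box n) : bool :=
  [forall i, (j i <= k i)%N].

(* Negative association of a finite family {Y_i ; i in I}:
   for disjoint A, B subsets of I and coordinatewise non-decreasing f, g
   depending only on the coordinates in A (resp. B), Cov(f(Y_A), g(Y_B)) <= 0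
   whenever the covariance exists (f(Y), g(Y), f(Y)g(Y) integrable). *)
Definition neg_assoc (dT : measure_display) (T : measurableType dT)
  (R : realType) (P : probability T R) (I : finType) (Y : I -> T -> R) : Prop :=
  forall (A B : {set I}), [disjoint A & B] ->
  forall f g : (I -> R) -> R,
    (forall u v : I -> R, (forall i, i \in A -> u i = v i) -> f u = f v) ->
    (forall u v : I -> R, (forall i, i \in B -> u i = v i) -> g u = g v) ->
    (forall u v : I -> R, (forall i, u i <= v i) -> f u <= f v) ->
    (forall u v : I -> R, (forall i, u i <= v i) -> g u <= g v) ->
    let F := fun w => f (fun i => Y i w) in
    let G := fun w => g (fun i => Y i w) in
    F \in Lfun P 1 -> G \in Lfun P 1 -> (F \* G)%R \in Lfun P 1 ->
    (covariance P F G <= 0)%E.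

Definition psum (dT : measure_display) (T : measurableType dT) (R : realType)
  (d : nat) (n : 'I_d -> nat) (Y : box n -> T -> R) (k : box n) : T -> R :=
  fun w => \sum_(j : box n | leidx j k) Y j w.

Definition maxpsum (dT : measure_display) (T : measurableType dT) (R : realType)
  (d : nat) (n : 'I_d -> nat) (Y : box n -> T -> R) : T -> R :=
  fun w => \big[Num.max/0]_(k : box n) `|psum Y k w|.

(* Main.v *)
(* For a set A of indices let T_k(A) be the part of T_k indexed by A, and let
   D_k(A) = T_k(A) - T_k(~A), a random-sign version of T_k.
   - For a uniformly random A, Levy's reflection argument in each of the d
     coordinates bounds the tail of max_k |D_k(A)| by 2^d times that of the
     full signed sum, which splits into four sums over A or ~A of variables of
     one sign; negative association gives each of them a Bernstein bound.
     Hence some fixed A has q = P(max_k |D_k(A)| >= s) tiny.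
   - For this A, { max_k T_k(A) >= s + c } is increasing in the variables of A
     and { max_k T_k(~A) < c } is decreasing in those of ~A, so negative
     association gives P(max_k T_k(A) >= s + c) P(max_k T_k(~A) < c) <= q.
     As 2 T_k(~A) = T_k - D_k(A), Markov's inequality for max_k |T_k| bounds
     the second factor below as soon as 2c - s >= 2 E max_k |T_k| + 2x.
   - Finally T_k = T_k(A) + T_k(~A), so exceeding 2(s + c) forces one of the
     two parts to exceed s + c. The choice s = 6x gives 2(s + c) = 2 E M + 20x. *)
Require Import Defs.
From HB Require Import structures.
From mathcomp Require Import all_boot all_order all_algebra.
From mathcomp Require Import all_classical all_reals all_analysis.
From mathcomp Require Import measurable_realfun ring lra.
Import Order.TTheory GRing.Theory Num.Theory.
Local Open Scope ring_scope.

(** * Levy's inequality for random signs on a box *)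

(** A set [A] encodes a choice of signs, so that counting sets replaces probability under uniform
    random signs. *)
Definition signed {R : zmodType} {I : finType} (A : {set I}) (y : I -> R) (i : I) : R :=
  if i \in A then y i else - y i.

Section LevyInequality.
Variables (R : realDomainType).

(** The level [h] is the time of Levy's inequality, while the other coordinates are absorbed in [k].
    A signed sum and its reflection average to the truncated sum, so one of the two is large.
    Reflection preserves cardinality, hence the factor 2. *)
Lemma levy_step {I K : finType} (S : K -> pred I) (h : I -> nat) (N : nat)
    (y : I -> R) (s : R) :
  (#|[set A : {set I} | [exists k, exists t : 'I_N,
        (s <= `|\sum_(i | S k i && (h i <= t)%N) signed A y i|)%R]]|
   <= 2 * #|[set A : {set I} | [exists k, (s <= `|\sum_(i | S k i) signed A y i|)%R]]|)%N.
Proof.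
pose G (A : {set I}) (t : nat) :=
  [exists k, s <= `|\sum_(i | S k i && (h i <= t)%N) signed A y i|].
(* [find] returns [N] when no level is large, so [tau A < N] says that a large level exists. *)
pose tau A := find (G A) (iota 0 N).
have tauP A : (tau A < N)%N -> G A (tau A).
  move=> lt; have /(nth_find 0%N) : has (G A) (iota 0 N) by rewrite has_find size_iota.
  by rewrite nth_iota.
have tau_min A t : (t < tau A)%N -> G A t = false.
  move=> lt; have := before_find 0%N lt; rewrite nth_iota //.
  by apply: (leq_trans lt); rewrite -[leqRHS](size_iota 0) find_size.
have tau_max A : (tau A <= N)%N by rewrite -[leqRHS](size_iota 0) find_size.
(* Reflection principle: flip the signs of all the indices beyond the first level [tau A]
   at which some partial sum is large. *)
pose refl (A : {set I}) : {set I} := [set i | (i \in A) (+) (tau A < h i)%N].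
(* Sums up to level [tau A] do not see the flip. Hence [tau] is invariant under [refl], and [refl]
   is an involution. *)
have GR A t : (t <= tau A)%N -> G (refl A) t = G A t.
  move=> tA; apply: eq_existsb => k; congr (_ <= `| _ |).
  apply: eq_bigr => i /andP[_ it]; rewrite /signed inE.
  by rewrite ltnNge (leq_trans it tA) addbF.
have tauR A : tau (refl A) = tau A.
  apply/eqP; rewrite eqn_leq; apply/andP; split; rewrite leqNgt; apply/negP => lt.
    have := tau_min _ _ lt; rewrite GR// tauP//.
    by rewrite (leq_trans lt).
  have := tau_min _ _ lt; rewrite -GR ?(ltnW lt)// tauP//.
  by rewrite (leq_trans lt).
have reflK : involutive refl.
  by move=> A; apply/setP => i; rewrite !inE tauR addbK.
set E := (X in (_ <= 2 * #|pred_of_set X|)%N).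
have -> : (2 * #|E| = #|E| + #|refl @^-1: E|)%N.
  by rewrite card_preimset ?mul2n ?addnn//; exact: inv_inj.
apply: leq_trans (leq_card_setU _ _); apply: subset_leq_card.
apply/fintype.subsetP => A; rewrite inE => /existsP[k0 /existsP[t0 At0]].
have tauN : (tau A < N)%N.
  rewrite leqNgt; apply/negP => Nt.
  have : G A t0 by apply/existsP; exists k0.
  by rewrite tau_min// (leq_trans (ltn_ord t0)).
have /existsP[k Hk] := tauP _ tauN.
have two : \sum_(i | S k i) signed A y i + \sum_(i | S k i) signed (refl A) y i
   = (\sum_(i | S k i && (h i <= tau A)%N) signed A y i) *+ 2.
  rewrite -big_split/= [LHS](bigID (fun i => h i <= tau A)%N)/=.
  rewrite [X in _ + X]big1 ?addr0; last first.
    move=> i /andP[_]; rewrite -ltnNge => lt.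
    rewrite /signed inE lt addbT; case: (i \in A) => /=; by rewrite ?subrr ?addNr.
  rewrite mulr2n -big_split/=; apply: eq_bigr => i /andP[_ le].
  by rewrite /signed inE [(tau A < h i)%N]ltnNge le addbF.
rewrite !inE; case: (boolP [exists k, _]) => //= /existsPn/(_ k); rewrite -ltNge => A1.
apply/existsP; exists k; rewrite leNgt; apply/negP => A2.
have : `|(\sum_(i | S k i && (h i <= tau A)%N) signed A y i) *+ 2| < s + s.
  by rewrite -two (le_lt_trans (ler_normD _ _))// ltrD.
by rewrite normrMn mulr2n ltNge lerD.
Qed.

(** Induction on coordinates: [S j] constrains only the first [j] of them, and [levy_step] drops one
    constraint at the cost of a factor 2. At [j = 0] the full sum is left. *)
Lemma levy_box {d : nat} {n : 'I_d -> nat} (y : box n -> R) (s : R) :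
  (#|[set A : {set box n} | [exists k, (s <= `|\sum_(i | leidx i k) signed A y i|)%R]]|
   <= 2 ^ d * #|[set A : {set box n} | (s <= `|\sum_i signed A y i|)%R]|)%N.
Proof.
pose S (j : nat) (t i : box n) := [forall c : 'I_d, (c < j)%N ==> (i c <= t c)%N].
pose E j := [set A : {set box n} | [exists t, s <= `|\sum_(i | S j t i) signed A y i|]].
have EE j : (j <= d)%N -> (#|E j| <= 2 ^ j * #|E 0%N|)%N.
  elim: j => [|j IH] jd; first by rewrite expn0 mul1n.
  rewrite expnS -mulnA; apply: (@leq_trans (2 * #|E j|)%N); last first.
    by rewrite leq_mul2l IH// ltnW.
  pose j' := Ordinal jd.
  apply: leq_trans (levy_step (S j) (fun i : box n => i j') (n j') y s).
  apply: subset_leq_card; apply/fintype.subsetP => A; rewrite !inE => /existsP[t At].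
  apply/existsP; exists t; apply/existsP; exists (t j').
  congr (s <= `| _ |): At; apply: eq_bigl => i; apply/forallP/andP.
    move=> H; split; last by have := H j'; rewrite /= ltnSn.
    by apply/forallP => c; apply/implyP => cj; have := H c; rewrite ltnW// ltnS ltnW.
  move=> [/forallP H1 H2] c; apply/implyP; rewrite ltnS leq_eqVlt => /orP[/eqP cj|cj].
    by have -> : c = j' by exact: val_inj.
  by have := H1 c; rewrite cj.
apply: (@leq_trans #|E d|).
  apply: subset_leq_card; apply/fintype.subsetP => A; rewrite !inE => /existsP[k Ak].
  apply/existsP; exists k; congr (s <= `| _ |): Ak; apply: eq_bigl => i.
  by apply: eq_forallb => c; rewrite ltn_ord.
apply: (leq_trans (EE _ (leqnn d))); rewrite leq_mul2l; apply/orP; right.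
apply: subset_leq_card; apply/fintype.subsetP => A; rewrite !inE => /existsP[k].
congr (s <= `| _ |); apply: eq_bigl => i.
by apply/forallP => c; rewrite ltn0.
Qed.
End LevyInequality.

(** * Negatively associated families *)

Lemma expR_le_quadratic (R : realType) (u : R) : `|u| <= 1 -> expR u <= 1 + u + u ^+ 2.
Proof.
rewrite ler_norml => /andP[u1 u2].
(* With v = u / 8, [expR (- v) >= 1 - v] gives [expR u <= (1 - v) ^- 8]; 8 is large
   enough for this to be at most [1 + u + u ^+ 2] on [-1, 1]. *)
pose v := u / 8.
have uv : u = 8%:R * v by rewrite /v; field.
have v1 : - 1 <= 8 * v by rewrite /v; lra.
have v2 : 8 * v <= 1 by rewrite /v; lra.
have p0 : 0 <= 1 - v by lra.
have e1 : (1 - v) ^+ 8 * expR u <= 1.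
  rewrite uv expRM_natl -exprMn exprn_ile1 ?mulr_ge0 ?expR_ge0//.
  rewrite -ler_pdivlMr ?expR_gt0// mul1r -expRN.
  by rewrite (le_trans _ (expR_ge1Dx _)).
have e2 : 1 <= (1 - v) ^+ 8 * (1 + u + u ^+ 2).
  (* The binomial expansion cut after degree 4, with its coefficient 70 lowered to 63: the spare
     [7 * v ^+ 4] absorbs [- 56 * v ^+ 5] because [8 * v <= 1]. *)
  have b8 : 1 - 8 * v + 28 * v ^+ 2 - 56 * v ^+ 3 + 63 * v ^+ 4 <= (1 - v) ^+ 8.
    rewrite -subr_ge0; have -> : (1 - v) ^+ 8 -
      (1 - 8 * v + 28 * v ^+ 2 - 56 * v ^+ 3 + 63 * v ^+ 4)
      = v ^+ 2 ^+ 2 * (7 * (1 - 8 * v) + 4 * v ^+ 2 * (7 - 2 * v) + v ^+ 2 ^+ 2) by ring.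
    have h1 : 0 <= 4 * v ^+ 2 * (7 - 2 * v).
      by apply: mulr_ge0; [rewrite mulr_ge0 ?sqr_ge0|lra].
    by apply: mulr_ge0; [exact: sqr_ge0|have := sqr_ge0 (v ^+ 2); lra].
  have q0 : 0 <= 1 + u + u ^+ 2 by have := sqr_ge0 u; lra.
  apply: le_trans (ler_wpM2r q0 b8); rewrite -subr_ge0 uv.
  have -> : (1 - 8 * v + 28 * v ^+ 2 - 56 * v ^+ 3 + 63 * v ^+ 4) *
      (1 + 8 * v + (8 * v) ^+ 2) - 1 =
      v ^+ 2 * (28 - 344 * v + 1022 * v ^+ 2 + 385 * v ^+ 2 * (1 - 8 * v)
        + 4032 * v ^+ 2 ^+ 2) by ring.
  (* This quadratic has two real roots, both above 1/8, so the bound [8 * v <= 1] is essential. *)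
  have w : 0 <= 28 - 344 * v + 1022 * v ^+ 2.
    by have := sqr_ge0 (8 * v - 1); have := sqr_ge0 v; lra.
  have w' : 0 <= 385 * v ^+ 2 * (1 - 8 * v).
    by apply: mulr_ge0; [rewrite mulr_ge0 ?sqr_ge0|lra].
  by apply: mulr_ge0; [exact: sqr_ge0|have := sqr_ge0 (v ^+ 2); lra].
have p : 0 < (1 - v) ^+ 8 by rewrite exprn_gt0//; lra.
by rewrite -(ler_pM2l p) (le_trans e1).
Qed.

Local Open Scope classical_set_scope.

Section NegativeAssociation.
Context {dT : measure_display} {T : measurableType dT} {R : realType}.
Variable P : probability T R.

Lemma ae_bounded_Lfun1 (f : T -> R) (C : R) :
  measurable_fun [set: T] f -> {ae P, forall w, `|f w| <= C} -> f \in Lfun P 1.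
Proof.
move=> mf fC; apply/Lfun1_integrable/integrableP; split; first exact/measurable_EFinP.
apply: (@le_lt_trans _ _ (\int[P]_w (`|C|)%:E)%E); last first.
  by rewrite integral_cst//= probability_setT mule1 ltry.
apply: ae_ge0_le_integral => //.
- by do 2 apply: measurableT_comp => //.
- by apply: filterS fC => w fw _; rewrite /= lee_fin (le_trans fw)// ler_norm.
Qed.

(** Replacing [f u] by [- f (- u)] keeps monotonicity and the set of relevant coordinates, and
    changing both signs preserves the covariance. This turns upper tail bounds into lower ones. *)
Lemma neg_assoc_opp (I : finType) (Y : I -> T -> R) :
  neg_assoc P Y -> neg_assoc P (fun i w => - Y i w).
Proof.
move=> NA A B AB f g fA gB fm gm F G F1 G1 FG1.
rewrite -covarianceNN//.
pose opp (h : (I -> R) -> R) u := - h (fun i => - u i).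
apply: (NA A B AB (opp f) (opp g)).
- by move=> u v uv; congr (- _); apply: fA => i iA; rewrite uv.
- by move=> u v uv; congr (- _); apply: gB => i iA; rewrite uv.
- by move=> u v uv; rewrite lerN2; apply: fm => i; rewrite lerN2.
- by move=> u v uv; rewrite lerN2; apply: gm => i; rewrite lerN2.
- by rewrite -[X in X \in _]/(- F) rpredN.
- by rewrite -[X in X \in _]/(- G) rpredN.
- by rewrite [X in X \in _](_ : _ = F \* G)//; apply/funext => w /=; rewrite /opp mulrNN.
Qed.

Lemma neg_assoc_expectationM (I : finType) (Y : I -> T -> R) (A B : {set I})
    (f g : (I -> R) -> R) :
  neg_assoc P Y -> [disjoint A & B]%B ->
  (forall u v : I -> R, (forall i, i \in A -> u i = v i) -> f u = f v) ->
  (forall u v : I -> R, (forall i, i \in B -> u i = v i) -> g u = g v) ->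
  (forall u v : I -> R, (forall i, u i <= v i) -> f u <= f v) ->
  (forall u v : I -> R, (forall i, u i <= v i) -> g u <= g v) ->
  let F := fun w => f (fun i => Y i w) in
  let G := fun w => g (fun i => Y i w) in
  F \in Lfun P 1 -> G \in Lfun P 1 -> (F \* G)%R \in Lfun P 1 ->
  ('E_P[F \* G] <= 'E_P[F] * 'E_P[G])%E.
Proof.
move=> NA AB fA gB fm gm F G F1 G1 FG1.
have := NA A B AB f g fA gB fm gm F1 G1 FG1.
by rewrite covarianceE// sube_le0.
Qed.

(** Indicators of upward closed events are non-decreasing and bounded, hence admissible test
    functions. *)
Lemma neg_assoc_events (I : finType) (Y : I -> T -> R) (A B : {set I})
    (U V : (I -> R) -> bool) :
  neg_assoc P Y -> [disjoint A & B]%B ->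
  (forall u v : I -> R, (forall i, i \in A -> u i = v i) -> U u = U v) ->
  (forall u v : I -> R, (forall i, i \in B -> u i = v i) -> V u = V v) ->
  (forall u v : I -> R, (forall i, u i <= v i) -> U u -> U v) ->
  (forall u v : I -> R, (forall i, u i <= v i) -> V u -> V v) ->
  let EU := [set w | U (fun i => Y i w)] in
  let EV := [set w | V (fun i => Y i w)] in
  measurable EU -> measurable EV -> (P (EU `&` EV) <= P EU * P EV)%E.
Proof.
move=> NA AB UA VB Um Vm EU EV mU mV.
have ind (W : (I -> R) -> bool) :
    (fun w => (W (fun i => Y i w))%:R) = \1_[set w | W (fun i => Y i w)] :> (T -> R).
  apply/funext => w; rewrite indicE; congr (nat_of_bool _)%:R.
  by apply/idP/idP; rewrite in_setE.
have indL E : measurable E -> \1_E \in Lfun P 1.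
  move=> mE; apply: (@ae_bounded_Lfun1 _ 1) => //.
  by apply: aeW => w /=; rewrite indicE normr_nat lern1 leq_b1.
have mono (W : (I -> R) -> bool) :
    (forall u v : I -> R, (forall i, u i <= v i) -> W u -> W v) ->
    forall u v : I -> R, (forall i, u i <= v i) -> (W u)%:R <= (W v)%:R :> R.
  move=> Wm u v uv; rewrite ler_nat; have := Wm u v uv.
  by case: (W u) => // ->.
have := @neg_assoc_expectationM I Y A B (fun u => (U u)%:R) (fun u => (V u)%:R) NA AB.
rewrite /= !ind -/EU -/EV.
have <- : \1_(EU `&` EV) = \1_EU \* \1_EV :> (T -> R) by rewrite indicI.
rewrite !expectation_indic//; last exact: measurableI.
apply.
- by move=> u v /UA ->.
- by move=> u v /VB ->.
- exact: mono.
- exact: mono.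
- exact: indL.
- exact: indL.
- by apply: indL; exact: measurableI.
Qed.

Lemma measurable_cond_sum (I : finType) (Y : I -> T -> R) (Q : pred I) :
  (forall i, measurable_fun [set: T] (Y i)) ->
  measurable_fun [set: T] (fun w => \sum_(i | Q i) Y i w).
Proof.
move=> mY; rewrite (_ : (fun _ => _) = fun w => \sum_i if Q i then Y i w else 0).
  by apply: measurable_sum => i; case: (Q i).
by apply/funext => w; rewrite big_mkcond.
Qed.

(** * Exponential moments and Bernstein-type tails *)

Section ExponentialBound.
Variables (I : finType) (Y : I -> T -> R) (b : R).
Hypotheses (mY : forall i, measurable_fun [set: T] (Y i))
  (Y0 : forall i, ('E_P[Y i] = 0)%E)
  (Yb : forall i, {ae P, forall w, `|Y i w| <= b}).

Let m2 i := fine 'E_P[fun w => Y i w ^+ 2].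

Lemma Lfun1_bounded_sqr i : (fun w => Y i w ^+ 2) \in Lfun P 1.
Proof.
apply: (@ae_bounded_Lfun1 _ (b ^+ 2)); first exact: measurable_funX.
by apply: filterS (Yb i) => w Yw; rewrite normrX lerXn2r// nnegrE (le_trans _ Yw).
Qed.

Lemma expectation_sqr_ge0 i : 0 <= m2 i.
Proof. by rewrite fine_ge0// expectation_ge0// => w; rewrite sqr_ge0. Qed.

(** A crude bound that serves integrability; counting all of [I] makes it uniform in [A]. *)
Lemma ae_bounded_expR_sum (u : R) (A : {set I}) : 0 <= u ->
  {ae P, forall w, `|expR (u * \sum_(i in A) Y i w)| <= expR (u * (b *+ #|I|))}.
Proof.
move=> u0; have : {ae P, forall w, forall i, `|Y i w| <= b} by exact: filter_forall.
apply: filterS => w Yw.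
rewrite ger0_norm ?expR_ge0// ler_expR ler_wpM2l//.
rewrite (le_trans (ler_norm _))// (le_trans (ler_norm_sum _ _ _))//.
apply: (@le_trans _ _ (\sum_(i in I) b)); last by rewrite sumr_const.
rewrite [leRHS](bigID (mem A))/= -[leLHS]addr0 lerD ?ler_sum//.
by rewrite sumr_ge0// => i _; rewrite (le_trans _ (Yw i)).
Qed.

Lemma measurable_expR_sum (u : R) (A : {set I}) :
  measurable_fun [set: T] (fun w => expR (u * \sum_(i in A) Y i w)).
Proof.
apply: measurableT_comp => //; apply: measurable_funM => //.
exact: measurable_cond_sum.
Qed.

Lemma Lfun1_expR_sum (u : R) (A : {set I}) : 0 <= u ->
  (fun w => expR (u * \sum_(i in A) Y i w)) \in Lfun P 1.
Proof.
move=> u0; apply: (@ae_bounded_Lfun1 _ (expR (u * (b *+ #|I|)))).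
  exact: measurable_expR_sum.
exact: ae_bounded_expR_sum.
Qed.

(** The linear term of [expR_le_quadratic] vanishes since the mean is zero, and [1 + v <= expR v]
    puts the rest back in the exponent. *)
Lemma expectation_expR_le (u : R) (i : I) : 0 <= u -> u * b <= 1 ->
  ('E_P[fun w => expR (u * Y i w)] <= (expR (u ^+ 2 * m2 i))%:E)%E.
Proof.
move=> u0 ub.
pose Q : T -> R := (cst 1 \+ (u \o* Y i)) \+ (u ^+ 2 \o* (fun w => Y i w ^+ 2)).
have Y1 : Y i \in Lfun P 1 by apply: (@ae_bounded_Lfun1 _ b).
have Y2 := Lfun1_bounded_sqr i.
have QE w : Q w = 1 + u * Y i w + (u * Y i w) ^+ 2 by rewrite /Q /=; ring.
apply: (@le_trans _ _ 'E_P[Q]%E).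
  apply: expectation_le.
  - by apply: measurableT_comp => //; apply: measurable_funM.
  - apply: measurable_funD; first apply: measurable_funD => //.
      exact: measurable_funM.
    by apply: measurable_funM => //; exact: measurable_funX.
  - by move=> w; rewrite expR_ge0.
  - by move=> w; rewrite QE; nra.
  - apply: filterS (Yb i) => w Yw; rewrite QE expR_le_quadratic//.
    by rewrite normrM (ger0_norm u0) (le_trans _ ub)// ler_wpM2l.
have L0 : cst 1 \in Lfun P 1 by exact: Lfun_cst.
have LZ k (h : T -> R) : h \in Lfun P 1 -> k \o* h \in Lfun P 1.
  move=> h1; rewrite (_ : k \o* h = k *: h) ?rpredZ//.
  by apply/funext => w; rewrite /= mulrC.
have L1 : cst 1 \+ u \o* Y i \in Lfun P 1.
  by rewrite -[X in X \in _]/(cst 1 + u \o* Y i) rpredD// LZ.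
rewrite !expectationD ?expectationZl ?LZ//.
rewrite expectation_cst Y0 mule0 adde0.
rewrite -(fineK (expectation_fin_num Y2)) -EFinM -EFinD lee_fin.
exact: expR_ge1Dx.
Qed.

(** Peel off one index at a time. As [u >= 0], the two exponential factors are non-decreasing in
    disjoint groups of variables, so the expectation of the product is at most the product of the
    expectations, as if they were independent. *)
Lemma neg_assoc_expectation_expR_sum (u : R) (A : {set I}) :
  neg_assoc P Y -> 0 <= u -> u * b <= 1 ->
  ('E_P[fun w => expR (u * \sum_(i in A) Y i w)]
    <= (expR (u ^+ 2 * \sum_(i in A) m2 i))%:E)%E.
Proof.
move=> NA u0 ub.
elim: {A}_.+1 {-2}A (ltnSn #|A|) => // m IH A Am.
have [->|[a aA]] := set_0Vmem A.
  under eq_fun do rewrite big_set0 mulr0 expR0.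
  by rewrite big_set0 mulr0 expR0 expectation_cst.
pose f (v : I -> R) := expR (u * v a).
pose g (v : I -> R) := expR (u * \sum_(i in A :\ a) v i).
have FG : (fun w => expR (u * \sum_(i in A) Y i w)) =
  (fun w => f (fun i => Y i w)) \* (fun w => g (fun i => Y i w)).
  by apply/funext => w /=; rewrite (big_setD1 a aA)/= mulrDr expRD.
have f1 : (fun w => f (fun i => Y i w)) \in Lfun P 1.
  rewrite (_ : (fun _ => _) = fun w => expR (u * \sum_(i in [set a]%SET) Y i w)).
    exact: Lfun1_expR_sum.
  by apply/funext => w; rewrite big_set1.
rewrite FG; apply: (@le_trans _ _ ('E_P[fun w => f (fun i => Y i w)] *
   'E_P[fun w => g (fun i => Y i w)])%E).
  apply: (@neg_assoc_expectationM _ Y [set a]%SET (A :\ a) f g) => //.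
  - by rewrite disjoints1 !inE eqxx.
  - by move=> v w vw; rewrite /f vw// inE.
  - by move=> v w vw; rewrite /g; congr (expR (_ * _)); apply: eq_bigr.
  - by move=> v w vw; rewrite ler_expR ler_wpM2l.
  - by move=> v w vw; rewrite ler_expR ler_wpM2l// ler_sum.
  - exact: Lfun1_expR_sum.
  - by rewrite -FG Lfun1_expR_sum.
rewrite (big_setD1 a aA)/= mulrDr expRD EFinM.
apply: lee_pmul.
- by apply: expectation_ge0 => w; exact: expR_ge0.
- by apply: expectation_ge0 => w; exact: expR_ge0.
- exact: expectation_expR_le.
- by apply: IH; rewrite -ltnS (leq_trans _ Am)// ltnS [leqRHS](cardsD1 a) aA.
Qed.

(** Chernoff's bound. The second moments are summed over all of [I], which makes the estimate
    uniform in [A]. *)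
Lemma neg_assoc_tail_sum (u a : R) (A : {set I}) :
  neg_assoc P Y -> 0 < u -> u * b <= 1 ->
  (P [set w | (a <= \sum_(i in A) Y i w)%R]
    <= (expR (u ^+ 2 * (\sum_i m2 i) - u * a))%:E)%E.
Proof.
move=> NA u0 ub.
have mS : measurable_fun [set: T] (fun w => \sum_(i in A) Y i w).
  exact: measurable_cond_sum.
have := @chernoff _ _ _ P (mfun_Sub (mem_set mS)) u a u0.
move=> /le_trans; apply.
rewrite expRD EFinM lee_pmul2r ?lte_fin ?expR_gt0//.
rewrite /mmt_gen_fun.
apply: (@le_trans _ _ 'E_P[fun w => expR (u * \sum_(i in A) Y i w)]%E).
  rewrite le_eqVlt; apply/orP; left; apply/eqP; congr ('E_P[_]%E).
  by apply/funext => w /=; rewrite mulrC.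
apply: (@le_trans _ _ (expR (u ^+ 2 * \sum_(i in A) m2 i))%:E).
  by apply: neg_assoc_expectation_expR_sum => //; exact: ltW.
rewrite lee_fin ler_expR ler_wpM2l ?sqr_ge0//.
rewrite [leRHS](bigID (mem A))/= lerDl sumr_ge0// => i _.
exact: expectation_sqr_ge0.
Qed.
End ExponentialBound.
(** * Decoupling *)

Section Decoupling.

Lemma sum_signed (I : finType) (A : {set I}) (y : I -> R) (Q : pred I) :
  \sum_(i | Q i) signed A y i =
  \sum_(i | Q i && (i \in A)) y i - \sum_(i | Q i && (i \in ~: A)) y i.
Proof.
rewrite (bigID (mem A))/= -sumrN; congr (_ + _).
  by apply: eq_bigr => i /andP[_ iA]; rewrite /signed iA.
apply: eq_big => i; first by rewrite inE.
by move=> /andP[_ iA]; rewrite /signed (negbTE iA).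
Qed.

Lemma eq_exists_ge (K : finType) (f g : K -> T -> R) (t : R) :
  (forall k w, f k w = g k w) ->
  [set w | [exists k, t <= f k w]] = [set w | [exists k, t <= g k w]].
Proof.
move=> fg; apply/funext => w; congr (is_true _).
by apply: eq_existsb => k; rewrite fg.
Qed.

Lemma measurable_exists_ge (K : finType) (f : K -> T -> R) (t : R) :
  (forall k, measurable_fun [set: T] (f k)) ->
  measurable [set w | [exists k, t <= f k w]].
Proof.
move=> mf.
rewrite (_ : [set _ | _] = \bigcup_(k in [set: K]) (f k @^-1` `[t, +oo[)).
  apply: fin_bigcup_measurable => // k _.
  by rewrite -[X in measurable X]setTI; exact: mf.
apply/seteqP; split => w /=.
  by move=> /existsP[k kw]; exists k => //=; rewrite in_itv/= kw.
by move=> [k _] /=; rewrite in_itv/= andbT => kw; apply/existsP; exists k.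
Qed.

Let pr (E : set T) : R := fine (P E).

Lemma fine_probabilityK E : measurable E -> (pr E)%:E = P E.
Proof. by move=> mE; rewrite fineK// fin_num_measure. Qed.

Lemma fine_probability_le E F : measurable E -> measurable F -> E `<=` F -> pr E <= pr F.
Proof.
move=> mE mF EF; rewrite -lee_fin !fine_probabilityK//.
by apply: le_measure; rewrite ?inE.
Qed.

Lemma fine_probabilityU E F : measurable E -> measurable F ->
  pr (E `|` F) <= pr E + pr F.
Proof.
move=> mE mF; rewrite -lee_fin EFinD !fine_probabilityK//; last exact: measurableU.
exact: measureU2.
Qed.

Variables (I K : finType) (S : K -> pred I).

Let part (Y : I -> T -> R) (A : {set I}) k w := \sum_(i | S k i && (i \in A)) Y i w.

(** If [EU] holds at [k] and [EV] fails, the two parts differ by at least [s] at [k]. So P(EU) is at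
    most the right-hand side plus P(EU and EV), and negative association bounds the latter by P(EU)
    P(EV). *)
Lemma neg_assoc_decoupling (Y : I -> T -> R) (A B : {set I}) (s c : R) :
  (forall i, measurable_fun [set: T] (Y i)) ->
  neg_assoc P Y -> [disjoint A & B]%B ->
  pr [set w | [exists k, s + c <= part Y A k w]] *
    (1 - pr [set w | [exists k, c <= part Y B k w]])
  <= pr [set w | [exists k, s <= `|part Y A k w - part Y B k w| ]].
Proof.
move=> mY NA AB.
set EU := [set w | [exists k, s + c <= _]]; set EV := [set w | [exists k, c <= _]].
set D := [set w | _].
have mpart C k : measurable_fun [set: T] (part Y C k) by exact: measurable_cond_sum.
have mU : measurable EU by exact: measurable_exists_ge.
have mV : measurable EV by exact: measurable_exists_ge.
have mD : measurable D.
  apply: measurable_exists_ge => k; apply: measurableT_comp => //.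
  exact: measurable_funB.
have mono (C : {set I}) (t : R) (u v : I -> R) : (forall i, u i <= v i) ->
    [exists k, t <= \sum_(i | S k i && (i \in C)) u i] ->
    [exists k, t <= \sum_(i | S k i && (i \in C)) v i].
  move=> uv /existsP[k tk]; apply/existsP; exists k.
  by rewrite (le_trans tk)// ler_sum.
have dep (C : {set I}) (t : R) (u v : I -> R) : (forall i, i \in C -> u i = v i) ->
    [exists k, t <= \sum_(i | S k i && (i \in C)) u i] =
    [exists k, t <= \sum_(i | S k i && (i \in C)) v i].
  move=> uv; apply: eq_existsb => k; congr (t <= _).
  by apply: eq_bigr => i /andP[_ /uv].
have NAE : pr (EU `&` EV) <= pr EU * pr EV.
  rewrite -lee_fin EFinM !fine_probabilityK//; last exact: measurableI.
  apply: (@neg_assoc_events I Y A B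
    (fun u => [exists k, s + c <= \sum_(i | S k i && (i \in A)) u i])
    (fun u => [exists k, c <= \sum_(i | S k i && (i \in B)) u i])) => //.
  - exact: dep.
  - exact: dep.
  - exact: mono.
  - exact: mono.
have EUD : pr EU <= pr D + pr (EU `&` EV).
  apply: (@le_trans _ _ (pr (D `|` (EU `&` EV)))); last first.
    by apply: fine_probabilityU => //; exact: measurableI.
  apply: fine_probability_le => //; first by apply: measurableU => //; exact: measurableI.
  move=> w Uw; case: (pselect (EV w)) => Vw; [by right|left].
  move/existsP: Uw => [k kw]; apply/existsP; exists k.
  move/negP: Vw => /existsPn/(_ k); rewrite -ltNge => Vk.
  by rewrite (le_trans _ (ler_norm _))// lerBrDl; lra.
lra.
Qed.

Lemma decoupled_sum_tail (Y : I -> T -> R) (A : {set I}) (s c : R) :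
  (forall i, measurable_fun [set: T] (Y i)) -> neg_assoc P Y ->
  let p := pr [set w | [exists k, 2 * c - s <= `|\sum_(i | S k i) Y i w| ]] in
  let q := pr [set w | [exists k, s <= `|\sum_(i | S k i) signed A (Y^~ w) i| ]] in
  pr [set w | [exists k, s + c <= part Y A k w]] * (1 - p - q) <= q.
Proof.
move=> mY NA; lazy zeta; set q := (X in _ <= X); set p := (X in 1 - X - _).
have mpart C k : measurable_fun [set: T] (part Y C k) by exact: measurable_cond_sum.
have qE : q = pr [set w | [exists k, s <= `|part Y A k w - part Y (~: A) k w| ]].
  by congr (pr _); apply: eq_exists_ge => k w; rewrite sum_signed.
have mq : measurable [set w | [exists k, s <= `|part Y A k w - part Y (~: A) k w| ]].
  apply: measurable_exists_ge => k; apply: measurableT_comp => //.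
  exact: measurable_funB.
have mp : measurable [set w | [exists k, 2 * c - s <= `|\sum_(i | S k i) Y i w| ]].
  apply: measurable_exists_ge => k; apply: measurableT_comp => //.
  exact: measurable_cond_sum.
have AA : [disjoint A & ~: A]%B by rewrite finset.disjoints_subset finset.setCK.
have := @neg_assoc_decoupling Y A (~: A) s c mY NA AA; rewrite -qE.
have : pr [set w | [exists k, c <= part Y (~: A) k w]] <= p + q.
  rewrite qE; apply: (le_trans _ (fine_probabilityU _ _ mp mq)).
  apply: fine_probability_le => //; [exact: measurable_exists_ge|exact: measurableU|].
  move=> w /= /existsP[k kw].
  have TE : \sum_(i | S k i) Y i w = part Y A k w + part Y (~: A) k w.
    rewrite (bigID (mem A))/=; congr (_ + _); apply: eq_bigl => i.
    by rewrite inE.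
  (* If the full sum stays below [2 * c - s], subtracting twice the part on [~: A], which is at
     least [c], leaves a signed sum below [- s]. *)
  case: (lerP (2 * c - s) `|\sum_(i | S k i) Y i w|) => H; [left|right].
    by apply/existsP; exists k.
  apply/existsP; exists k; rewrite distrC (le_trans _ (ler_norm _))//.
  by have := le_lt_trans (ler_norm _) H; rewrite TE; lra.
have : 0 <= pr [set w | [exists k, s + c <= part Y A k w]] by rewrite fine_ge0.
move=> u0; rewrite /q => vpq UV; rewrite (le_trans _ UV)// ler_wpM2l//; lra.
Qed.

(** The factor 4 counts the two signs of the sum times the two halves [A] and [~: A]; one half
    carries at least half of the total. *)
Lemma neg_assoc_max_tail (Y : I -> T -> R) (A : {set I}) (s c : R) :
  (forall i, measurable_fun [set: T] (Y i)) -> neg_assoc P Y ->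
  let p := pr [set w | [exists k, 2 * c - s <= `|\sum_(i | S k i) Y i w| ]] in
  let q := pr [set w | [exists k, s <= `|\sum_(i | S k i) signed A (Y^~ w) i| ]] in
  p + q <= 1 ->
  pr [set w | [exists k, 2 * (s + c) <= `|\sum_(i | S k i) Y i w| ]] * (1 - p - q)
    <= 4 * q.
Proof.
move=> mY NA p q pq.
pose Z (e : bool) : I -> T -> R := if e then Y else (fun i w => - Y i w).
pose C (e : bool) := if e then A else ~: A.
pose E e1 e2 := [set w | [exists k, s + c <= part (Z e1) (C e2) k w]].
have mZ e i : measurable_fun [set: T] (Z e i).
  by case: e => //=; exact: measurable_funN.
have mE e1 e2 : measurable (E e1 e2).
  by apply: measurable_exists_ge => k; exact: measurable_cond_sum.
have bound e1 e2 : pr (E e1 e2) * (1 - p - q) <= q.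
  have NZ : neg_assoc P (Z e1) by case: e1 => //=; exact: neg_assoc_opp.
  have := @decoupled_sum_tail (Z e1) (C e2) s c (mZ e1) NZ.
  (* Negating [Y] or exchanging [A] with its complement only changes signs inside absolute values,
     so all four cases share the same [p] and [q]. *)
  have ZT Q w : `|\sum_(i | Q i) Z e1 i w| = `|\sum_(i | Q i) Y i w|.
    by case: e1 {NZ} => //=; rewrite sumrN normrN.
  have ZS k w : `|\sum_(i | S k i) signed (C e2) ((Z e1)^~ w) i| =
      `|\sum_(i | S k i) signed A (Y^~ w) i|.
    have -> : `|\sum_(i | S k i) signed (C e2) ((Z e1)^~ w) i| =
       `|\sum_(i | S k i) signed (C e2) (Y^~ w) i|.
      case: e1 {NZ ZT} => //=; rewrite -normrN -sumrN; congr `| _ |.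
      by apply: eq_bigr => i _; rewrite /signed; case: ifP; rewrite ?opprK.
    case: e2 => //=; rewrite -normrN -sumrN; congr `| _ |.
    by apply: eq_bigr => i _; rewrite /signed inE; case: (i \in A); rewrite ?opprK.
  have -> : [set w | [exists k, 2 * c - s <= `|\sum_(i | S k i) Z e1 i w| ]] =
    [set w | [exists k, 2 * c - s <= `|\sum_(i | S k i) Y i w| ]].
    by apply: eq_exists_ge => k w; rewrite ZT.
  have -> : [set w | [exists k, s <= `|\sum_(i | S k i) signed (C e2) ((Z e1)^~ w) i| ]] =
    [set w | [exists k, s <= `|\sum_(i | S k i) signed A (Y^~ w) i| ]].
    by apply: eq_exists_ge => k w; rewrite ZS.
  by [].
have mEU e : measurable (E e true `|` E e false) by exact: measurableU.
set M := [set w | _].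
have ME : pr M <= (pr (E true true) + pr (E true false)) +
    (pr (E false true) + pr (E false false)).
  apply: (@le_trans _ _ (pr ((E true true `|` E true false) `|`
    (E false true `|` E false false)))); last first.
    apply: (le_trans (fine_probabilityU _ _ (mEU true) (mEU false))).
    by apply: lerD; exact: fine_probabilityU.
  apply: fine_probability_le.
  - apply: measurable_exists_ge => k; apply: measurableT_comp => //.
    exact: measurable_cond_sum.
  - exact: measurableU.
  move=> w /= /existsP[k]; rewrite ler_normr => kw.
  have [e ke] : exists e, 2 * (s + c) <= \sum_(i | S k i) Z e i w.
    by case/orP: kw => kw; [exists true|exists false; rewrite sumrN].
  suff [e2 k2] : exists e2, E e e2 w by case: e e2 k2 {ke} => -[]; tauto.
  have TE : \sum_(i | S k i) Z e i w = part (Z e) A k w + part (Z e) (~: A) k w.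
    rewrite (bigID (mem A))/=; congr (_ + _); apply: eq_bigl => i.
    by rewrite inE.
  case: (lerP (s + c) (part (Z e) A k w)) => H.
    by exists true; apply/existsP; exists k.
  by exists false; apply/existsP; exists k; lra.
have pq0 : 0 <= 1 - p - q by lra.
apply: (le_trans (ler_wpM2r pq0 ME)).
by rewrite !mulrDl; have := bound true true; have := bound true false;
  have := bound false true; have := bound false false; lra.
Qed.

End Decoupling.

(** The sum of the probabilities is the expected number of events that occur, so a pointwise
    comparison of counts can be integrated. This averages over signs without a product space. *)
Lemma sum_probability_le_card (J : finType) (D F : J -> T -> bool) (m : nat) :
  (forall j, measurable [set w | D j w]) -> (forall j, measurable [set w | F j w]) ->
  (forall w, #|[set j | D j w]%SET| <= m * #|[set j | F j w]%SET|)%N ->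
  (\sum_j P [set w | D j w] <= m%:R%:E * \sum_j P [set w | F j w])%E.
Proof.
move=> mD mF DF.
have mind (G : J -> T -> bool) j : measurable [set w | G j w] ->
    measurable_fun [set: T] (fun w => ((G j w)%:R : R)%:E).
  move=> mG; rewrite (_ : (fun _ => _) = EFin \o \1_[set w | G j w]).
    by apply/measurable_EFinP; exact: measurable_indic.
  apply/funext => w /=; rewrite indicE; congr (nat_of_bool _)%:R%:E.
  by apply/idP/idP; rewrite in_setE.
have cardE (G : J -> T -> bool) w :
    (#|[set j | G j w]%SET|%:R : R)%:E = (\sum_j ((G j w)%:R)%:E)%E.
  rewrite -sum1_card sumEFin; congr EFin.
  by rewrite natr_sum [LHS]big_mkcond/=; apply: eq_bigr => j _; rewrite inE; case: (G j w).
have mcard (G : J -> T -> bool) : (forall j, measurable [set w | G j w]) ->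
    measurable_fun [set: T] (fun w => (#|[set j | G j w]%SET|%:R : R)%:E).
  move=> mG; rewrite (_ : (fun _ => _) = fun w => (\sum_j ((G j w)%:R)%:E)%E).
    by apply: emeasurable_sum => j; exact: mind.
  by apply/funext => w; rewrite cardE.
have sumE (G : J -> T -> bool) : (forall j, measurable [set w | G j w]) ->
    (\sum_j P [set w | G j w] = \int[P]_w (#|[set j | G j w]%SET|%:R)%:E)%E.
  move=> mG; transitivity (\sum_j \int[P]_w ((G j w)%:R)%:E)%E.
    apply: eq_bigr => j _; rewrite -[in LHS](setIT [set w | G j w]).
    rewrite -integral_indic//; apply: eq_integral => w _; rewrite indicE.
    by congr (nat_of_bool _)%:R%:E; apply/idP/idP; rewrite in_setE.
  rewrite -ge0_integral_sum//; last by move=> j; exact: mind.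
  by apply: eq_integral => w _; rewrite cardE.
rewrite !sumE// -ge0_integralZl//; last exact: mcard.
apply: ge0_le_integral => //.
- exact: mcard.
- by apply: emeasurable_funM => //; exact: mcard.
- by move=> w _; rewrite -EFinM lee_fin -natrM ler_nat.
Qed.

End NegativeAssociation.

(** * Random signs and maximal partial sums *)

Section MaximalPartialSums.
Context {dT : measure_display} {T : measurableType dT} {R : realType}.
Variable P : probability T R.

Lemma signed_sum_tail (I : finType) (Y : I -> T -> R) (b x : R) (A : {set I}) :
  (forall i, measurable_fun [set: T] (Y i)) ->
  (forall i, 'E_P[Y i] = 0)%E ->
  (forall i, {ae P, forall w, `|Y i w| <= b}) ->
  neg_assoc P Y -> 0 < b -> 0 < x ->
  let B2 := \sum_i fine 'E_P[fun w => Y i w ^+ 2] in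
  (P [set w | (6 * x <= `|\sum_i signed A (Y^~ w) i|)%R]
    <= (4 * expR (- (x ^+ 2 / (2 * (b * x + B2)))) ^+ 4)%:E)%E.
Proof.
move=> mY Y0 Yb NA b0 x0; lazy zeta; set B2 := \sum_i _.
have B20 : 0 <= B2 by apply: sumr_ge0 => i _; exact: expectation_sqr_ge0.
have D0 : 0 < b * x + B2 by rewrite ltr_pwDl// mulr_gt0.
(* This choice gives both [u * b <= 1] and [u * B2 <= x], so the exponent
   [u ^+ 2 * B2 - u * (3 * x)] is at most [- 2 * u * x], four times the target exponent. *)
pose u := x / (b * x + B2).
have u0 : 0 < u by rewrite divr_gt0.
have ub : u * b <= 1.
  by rewrite /u mulrAC ler_pdivrMr// mul1r [x * b]mulrC lerDl.
pose Z (e : bool) : I -> T -> R := if e then Y else (fun i w => - Y i w).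
pose C (e : bool) := if e then A else ~: A.
pose E e1 e2 := [set w | 3 * x <= \sum_(i in C e2) Z e1 i w].
have mZ e i : measurable_fun [set: T] (Z e i).
  by case: e => //=; exact: measurable_funN.
have mE e1 e2 : measurable (E e1 e2).
  rewrite -[X in measurable X]setTI.
  rewrite (_ : E e1 e2 = (fun w => \sum_(i in C e2) Z e1 i w) @^-1` `[3 * x, +oo[).
    by apply: measurable_cond_sum => //.
  by apply/seteqP; split => w; rewrite /E/= in_itv/= andbT.
have tail e1 e2 : (P (E e1 e2) <=
    (expR (- (x ^+ 2 / (2 * (b * x + B2)))) ^+ 4)%:E)%E.
  have NZ : neg_assoc P (Z e1) by case: e1 => //=; exact: neg_assoc_opp.
  have Z0 i : 'E_P[Z e1 i]%E = 0%E.
    case: e1 {NZ} => //=.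
    rewrite (_ : (fun _ => _) = -1 \o* Y i); last by apply/funext => w; rewrite /= mulrN1.
    by rewrite expectationZl ?Y0 ?mule0//; exact: (@ae_bounded_Lfun1 _ _ _ P _ b).
  have Zb i : {ae P, forall w, `|Z e1 i w| <= b}.
    by case: e1 {NZ Z0} => //=; apply: filterS (Yb i) => w; rewrite normrN.
  have := @neg_assoc_tail_sum _ _ _ P I (Z e1) b (mZ e1) Z0 Zb u (3 * x) (C e2) NZ u0 ub.
  move=> /le_trans; apply; rewrite lee_fin.
  have -> : \sum_i fine 'E_P[fun w => Z e1 i w ^+ 2] = B2.
    apply: eq_bigr => i _; congr (fine 'E_P[_]%E); apply/funext => w.
    by case: e1 {NZ Z0 Zb} => //=; rewrite sqrrN.
  rewrite -expRM_natl ler_expR.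
  have -> : 4%:R * - (x ^+ 2 / (2 * (b * x + B2))) = - (2 * (u * x)).
    by rewrite /u; field; lra.
  have uB : u * B2 <= x.
    rewrite /u mulrAC ler_pdivrMr// ler_pM2l// lerDr.
    by rewrite mulr_ge0// ltW.
  have : u * (u * B2) <= u * x by rewrite ler_pM2l.
  by rewrite expr2 mulrA; lra.
have mS : measurable [set w | 6 * x <= `|\sum_i signed A (Y^~ w) i| ].
  rewrite -[X in measurable X]setTI.
  rewrite (_ : [set w | _] = (fun w => `|\sum_i signed A (Y^~ w) i|) @^-1` `[6 * x, +oo[).
    apply: measurableT_comp => //.
    apply: measurable_sum => i; rewrite /signed; case: (i \in A) => //.
    exact: measurable_funN.
  by apply/seteqP; split => w; rewrite /= in_itv/= andbT.
have mEU e : measurable (E e true `|` E e false) by exact: measurableU.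
apply: (@le_trans _ _ (P ((E true true `|` E true false) `|`
    (E false true `|` E false false)))).
  (* If plus and minus both partial sums are all below [3 * x], their difference is below [6 * x] in
     absolute value. *)
  apply: le_measure; rewrite ?inE//; first exact: measurableU.
  move=> w /=; rewrite sum_signed/= => Sw.
  rewrite /E /= !sumrN.
  set s1 := \sum_(i in A) _ in Sw *; set s2 := \sum_(i in ~: A) _ in Sw *.
  case: (lerP (3 * x) s1) => h1; first by left; left.
  case: (lerP (3 * x) s2) => h2; first by left; right.
  case: (lerP (3 * x) (- s1)) => h3; first by right; left.
  case: (lerP (3 * x) (- s2)) => h4; first by right; right.
  by move: Sw; rewrite ler_normr => /orP[]; lra.
apply: (le_trans (measureU2 _ (mEU true) (mEU false))).
apply: (le_trans (leeD (measureU2 _ (mE _ _) (mE _ _)) (measureU2 _ (mE _ _) (mE _ _)))).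
apply: (le_trans (leeD (leeD (tail _ _) (tail _ _)) (leeD (tail _ _) (tail _ _)))).
by rewrite -!EFinD lee_fin; lra.
Qed.

(** Probabilistic method: [levy_box], applied at each [w] and integrated, bounds the average over
    [A], so not every [A] can exceed the bound. *)
Lemma exists_signs_max_tail (d : nat) (n : 'I_d -> nat) (Y : box n -> T -> R) (s e : R) :
  (forall i, measurable_fun [set: T] (Y i)) ->
  (forall A, P [set w | (s <= `|\sum_i signed A (Y^~ w) i|)%R] <= e%:E)%E ->
  exists A, (P [set w | [exists k, s <= `|\sum_(i | leidx i k) signed A (Y^~ w) i|]%R]
    <= (2 ^+ d * e)%:E)%E.
Proof.
move=> mY He; apply: contrapT => /forallNP H.
have mS A Q : measurable_fun [set: T] (fun w => `|\sum_(i | Q i) signed A (Y^~ w) i|).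
  apply: measurableT_comp => //; apply: measurable_cond_sum => i.
  by rewrite /signed; case: (i \in A) => //; exact: measurable_funN.
pose D (A : {set box n}) w := [exists k, s <= `|\sum_(i | leidx i k) signed A (Y^~ w) i|].
pose F (A : {set box n}) w := s <= `|\sum_i signed A (Y^~ w) i|.
have mD A : measurable [set w | D A w] by exact: measurable_exists_ge.
have mF A : measurable [set w | F A w].
  rewrite (_ : [set w | F A w] = [set w | [exists k : 'I_1, s <= `|\sum_i signed A (Y^~ w) i|]]).
    exact: measurable_exists_ge.
  apply/seteqP; split => w /=; first by move=> Fw; apply/existsP; exists ord0.
  by move=> /existsP[].
have := @sum_probability_le_card _ _ _ P _ D F (2 ^ d)%N mD mF
  (fun w => @levy_box R d n (Y^~ w) s).
apply/negP; rewrite -ltNge.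
have finP E : measurable E -> P E = (fine (P E))%:E.
  by move=> mE; rewrite fineK// fin_num_measure.
rewrite (eq_bigr _ (fun A _ => finP _ (mF A))) [ltRHS](eq_bigr _ (fun A _ => finP _ (mD A))).
rewrite !sumEFin -EFinM lte_fin natrX.
apply: (@le_lt_trans _ _ (\sum_(A : {set box n}) 2 ^+ d * e)).
  rewrite mulr_sumr; apply: ler_sum => A _; rewrite ler_pM2l ?exprn_gt0//.
  by rewrite -lee_fin -finP//; exact: He.
(* A strict inequality of sums needs at least one summand; the empty set provides it. *)
apply: ltr_sum => [|A _].
  by apply/hasP; exists finset.set0 => //; rewrite mem_index_enum.
by move/negP: (H A); rewrite -ltNge (finP _ (mD A)) lte_fin.
Qed.

(** The maximum starts from the default 0; taking [t > 0] ensures that the value is attained at an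
    actual index. *)
Lemma maxpsum_geP (d : nat) (n : 'I_d -> nat) (Y : box n -> T -> R) (t : R) (w : T) :
  0 < t -> (t <= maxpsum Y w) = [exists k, t <= `|psum Y k w|].
Proof.
move=> t0; apply/bigmax_geP/existsP => [[|[k _ kt]]|[k kt]].
- by rewrite leNgt t0.
- by exists k.
- by right; exists k.
Qed.

Lemma measurable_maxpsum (d : nat) (n : 'I_d -> nat) (Y : box n -> T -> R) :
  (forall i, measurable_fun [set: T] (Y i)) -> measurable_fun [set: T] (maxpsum Y).
Proof.
move=> mY; rewrite /maxpsum; elim: (index_enum (box n)) => [|k r IH].
  by under eq_fun do rewrite big_nil; exact: measurable_cst.
under eq_fun do rewrite big_cons.
apply: measurable_maxr => //; apply: measurableT_comp => //.
exact: measurable_cond_sum.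
Qed.

Lemma maxpsum_ge0 (d : nat) (n : 'I_d -> nat) (Y : box n -> T -> R) w : 0 <= maxpsum Y w.
Proof. exact: bigmax_ge_id. Qed.

Lemma Lfun1_maxpsum (d : nat) (n : 'I_d -> nat) (Y : box n -> T -> R) (b : R) :
  0 <= b -> (forall i, measurable_fun [set: T] (Y i)) ->
  (forall i, {ae P, forall w, `|Y i w| <= b}) -> maxpsum Y \in Lfun P 1.
Proof.
move=> b0 mY Yb; apply: (@ae_bounded_Lfun1 _ _ _ P _ (b *+ #|box n|)).
  exact: measurable_maxpsum.
have : {ae P, forall w, forall i, `|Y i w| <= b} by exact: filter_forall.
apply: filterS => w Yw; rewrite ger0_norm ?maxpsum_ge0//.
apply: bigmax_le => [|k _]; first by rewrite mulrn_wge0.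
rewrite (le_trans (ler_norm_sum _ _ _))//.
apply: (@le_trans _ _ (\sum_(i : box n) b)); last by rewrite sumr_const.
rewrite big_mkcond; apply: ler_sum => i _; case: ifP => // _.
Qed.

End MaximalPartialSums.

(** * The maximal inequality: choice of constants *)

Theorem theorem2p3 (dT : measure_display) (T : measurableType dT)
  (R : realType) (P : probability T R)
  (d : nat) (n : 'I_d -> nat) (Y : box n -> {RV P >-> R}) (b : R) :
  (0 < d)%N ->
  (forall i, 0 < n i)%N ->
  neg_assoc P (fun k => (Y k : T -> R)) ->
  (forall k, 'E_P[Y k] = 0)%E ->
  0 < b ->
  (forall k, {ae P, forall w, `|Y k w| <= b}) ->
  forall x : R, 0 < x ->
  let Mn := maxpsum (fun k => (Y k : T -> R)) in
  let Bn2 := \sum_(k : box n) fine 'E_P[fun w => Y k w ^+ 2] in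
  (P [set w : T | ((20 * x)%:E <= (Mn w)%:E - 2%:E * 'E_P[Mn])%E]
    <= ((2 ^+ d.+1)%:R * expR (- (x ^+ 2 / (2 * (b * x + Bn2)))))%:E)%E.
Proof.
move=> d0 n0; pose Z (k : box n) : T -> R := Y k.
rewrite -/Z => NA Y0 b0 Yb x x0; lazy zeta.
set M := maxpsum _; set B2 := \sum_k _.
have mZ k : measurable_fun [set: T] (Z k) by exact: measurable_funPT.
set a := expR _; set N : R := (2 ^+ d.+1)%:R.
have a0 : 0 < a by exact: expR_gt0.
have M1 : M \in Lfun P 1 by exact: (Lfun1_maxpsum P d n Z b (ltW b0) mZ Yb).
have mM : measurable_fun [set: T] M by exact: (measurable_maxpsum d n Z mZ).
pose m := fine 'E_P[M].
have mE : ('E_P[M] = m%:E)%E by rewrite fineK// expectation_fin_num.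
have m0 : 0 <= m by rewrite fine_ge0// expectation_ge0// => w; exact: maxpsum_ge0.
pose L (t : R) := [set w | [exists k, t <= `|\sum_(i | leidx i k) Z i w| ]].
have LM (t : R) : 0 < t -> L t = [set w | t <= M w].
  by move=> t0; apply/seteqP; split => w /=; rewrite maxpsum_geP.
have mL (t : R) : measurable (L t).
  apply: measurable_exists_ge => k; apply: measurableT_comp => //.
  exact: measurable_cond_sum.
(* Here [s = 6 * x] and [c = m + 4 * x], so that [2 * (s + c) = 2 * m + 20 * x]. *)
have -> : [set w : T | ((20 * x)%:E <= (M w)%:E - 2%:E * 'E_P[M])%E] =
    L (2 * (6 * x + (m + 4 * x))).
  rewrite LM; last by lra.
  by apply/seteqP; split => w /=; rewrite mE -EFinM -EFinB lee_fin; lra.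
(* The claim is trivial when its right-hand side is at least 1; otherwise [a] is small, which pays
   for the constants below. *)
have [Na1|Na1] := lerP 1 (N * a).
  by apply: (@le_trans _ _ 1%E); [exact: probability_le1|rewrite lee_fin].
have [A PA] := exists_signs_max_tail P d n Z (6 * x) _ mZ
  (fun A => signed_sum_tail P _ Z b x A mZ Y0 Yb NA b0 x0).
pose t := 2 * (m + 4 * x) - 6 * x.
have t0 : 0 < t by rewrite /t; lra.
(* Markov's inequality, with [t = 2 * m + 2 * x] at least twice the mean [m]. *)
have half : fine (P (L t)) <= 2^-1.
  have mk : (t%:E * P (L t) <= m%:E)%E.
    rewrite -mE LM//.
    have := @markov _ _ _ P (mfun_Sub (mem_set mM)) id t t0 (@measurable_id _ _ _)
      (fun r r0 => r0) (fun x y _ _ xy => xy).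
    congr (_ * P _ <= 'E_P[_])%E; last by apply/funext => w /=; rewrite ger0_norm// maxpsum_ge0.
    by apply/seteqP; split => w /=; rewrite lee_fin ger0_norm// maxpsum_ge0.
  move: mk; rewrite -(fine_probabilityK P _ (mL t)) -EFinM lee_fin => mk.
  by rewrite -(ler_pM2l t0) (le_trans mk)// /t; lra.
set Q := [set w | _] in PA.
have mQ : measurable Q.
  apply: measurable_exists_ge => k; apply: measurableT_comp => //.
  apply: measurable_cond_sum => i.
  by rewrite /signed; case: (i \in A) => //; exact: measurable_funN.
(* The bound [2 ^+ d * (4 * a ^+ 4)] equals [N * a * (2 * a ^+ 3)]. Since [d >= 1], [N >= 4], so
   [N * a < 1] forces [a <= 1/4] and [2 * a ^+ 3 <= 1/32]. *)
have q : fine (P Q) <= N * a / 32.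
  move: PA; rewrite -(fine_probabilityK P _ mQ) lee_fin => /le_trans; apply.
  have NE : N = 2 * 2 ^+ d by rewrite /N natrX exprS.
  have k2 : 2 <= 2 ^+ d :> R.
    by rewrite -(prednK d0) exprS ler_peMr// exprn_ege1// ler1n.
  have a4 : a <= 4^-1 by move: Na1; rewrite NE; nra.
  have a3 : a ^+ 3 <= 4^-1 ^+ 3 by rewrite lerXn2r// nnegrE ?invr_ge0// ltW.
  have : 0 <= N * a by rewrite mulr_ge0// ?ler0n// ltW.
  rewrite NE -/a => Na0.
  have -> : 2 ^+ d * (4 * a ^+ 4) = (2 * 2 ^+ d * a) * (2 * a ^+ 3) by ring.
  by rewrite ler_wpM2l//; lra.
have H : fine (P (L (2 * (6 * x + (m + 4 * x))))) * (1 - fine (P (L t)) - fine (P Q))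
    <= 4 * fine (P Q).
  by apply: (neg_assoc_max_tail P _ _ (fun k i => leidx i k) Z A _ _ mZ NA); lra.
rewrite -(fine_probabilityK P _ (mL _)) lee_fin.
set r := fine _ in H *.
have r0 : 0 <= r by rewrite fine_ge0.
(* The constant is 1 - 1/2 - 1/32; then [r] is at most 4/15 of [N * a]. *)
have : r * (15 / 32) <= r * (1 - fine (P (L t)) - fine (P Q)) by rewrite ler_wpM2l//; lra.
by lra.
Qed.
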